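(* Let $0\le\lambda<\sqrt6$ and consider the system $$S'=-\tfrac{1}{3\sqrt3}-\tfrac23S+\tfrac1{\sqrt3}S^2+\tfrac1{\sqrt3}U^2+\tfrac1{2\sqrt3}P^2+2S^3-SU^2+SP^2,$$ $$U'=U\bigl(\tfrac13-\tfrac\lambda2P+2S^2-U^2+P^2\bigr),\qquad P'=-\tfrac23P+\lambda U^2+2S^2P-U^2P+P^3,$$ restricted to the invariant (Bianchi I) surface $W=\{(S,U,P)\in\mathbb{R}^3: S^2+U^2+\frac12P^2=\frac13\}$. Then the critical point $P_2=\Bigl(0,\sqrt{\tfrac{6-\lambda^2}{18}},\tfrac\lambda3\Bigr)\in W$ is asymptotically stable (for $\tau\to\infty$) for the system restricted to $W$; thus Bianchi I solutions starting near $P_2$ satisfy $\sigma/\theta=S\to0$ (isotropization). Moreover, for $0<\lambda<\sqrt 6$ the exact solution corresponding to $P_2$, $$\theta=\frac{6}{\lambda^2t},\quad\sigma=0,\quad\psi=\frac2{\lambda t},\quad V=\frac{2(6-\lambda^2)}{\lambda^4t^2}\qquad(t>0),$$ is inflationary, i.e. $\psi^2-V<0$, for $\lambda<\sqrt2$, and is not inflationary for $\sqrt2\le\lambda<\sqrt6$. In particular, for $\sqrt2<\lambda<\sqrt6$, isotropy is reached without inflation in the Bianchi I universe.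
   Context: The system comes from the Einstein–Klein–Gordon equations with potential $V=V_0e^{-\lambda\varphi}$ via $\sigma=S\theta$, $\sqrt V=U\theta$, $\psi=\dot\varphi=P\theta$, with $\theta>0$ the expansion, $\sigma$ the shear and $'=\frac{d}{d\tau}=\frac1\theta\frac d{dt}$. Bianchi I solutions are those lying on $W$. Isotropization means $\sigma/\theta\to0$ at late times. Inflation of a solution means violation of the energy condition, $\psi^2-V<0$. Asymptotic stability is in the sense of Lyapunov. *)

(* Defs.v *)
From Stdlib Require Import Reals Lra.
From Coquelicot Require Import Coquelicot.
Open Scope R_scope.

(* Points of R^3, written (S, U, P).  Coquelicot's product norm is
   sqrt (|x|^2 + |y|^2), so [norm] on this type is the Euclidean norm. *)
Notation state := (R * R * R)%type.

Definition euclidean_dist (x y : state) : R := norm (minus x y).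

Definition in_interval (a b : Rbar) (t : R) : Prop := Rbar_lt a t /\ Rbar_lt t b.

Definition solution (f : state -> state) (a b : Rbar) (x : R -> state) : Prop :=
  forall t : R, in_interval a b t -> is_derive x t (f (x t)).

Definition invariant (f : state -> state) (W : state -> Prop) : Prop :=
  forall (a b : Rbar) (x : R -> state) (t0 : R),
    solution f a b x -> in_interval a b t0 -> W (x t0) ->
    forall t : R, in_interval a b t -> W (x t).

Definition solution_in (f : state -> state) (W : state -> Prop)
    (a b : Rbar) (x : R -> state) : Prop :=
  solution f a b x /\ forall t : R, in_interval a b t -> W (x t).

(* Lyapunov stability of p for the system restricted to W.  Forward
   completeness near p is part of the definition; the estimate is required of
   every solution, including those only given on a bounded interval. *)
Definition lyapunov_stable (f : state -> state) (W : state -> Prop) (p : state) : Prop :=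
  forall eps : R, 0 < eps -> exists delta : R, 0 < delta /\
    forall x0 : state, W x0 -> euclidean_dist x0 p < delta ->
      (exists (a : Rbar) (x : R -> state),
          Rbar_lt a 0 /\ solution_in f W a p_infty x /\ x 0 = x0) /\
      (forall (a b : Rbar) (x : R -> state),
          in_interval a b 0 -> solution_in f W a b x -> x 0 = x0 ->
          forall t : R, 0 <= t -> Rbar_lt t b -> euclidean_dist (x t) p < eps).

Definition attractive (f : state -> state) (W : state -> Prop) (p : state) : Prop :=
  exists delta : R, 0 < delta /\
    forall (a : Rbar) (x : R -> state),
      Rbar_lt a 0 -> solution_in f W a p_infty x -> euclidean_dist (x 0) p < delta ->
      filterlim x (Rbar_locally p_infty) (locally p).

Definition asymptotically_stable (f : state -> state) (W : state -> Prop) (p : state) : Prop :=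
  lyapunov_stable f W p /\ attractive f W p.

Definition S_coord (x : state) : R := fst (fst x).
Definition U_coord (x : state) : R := snd (fst x).
Definition P_coord (x : state) : R := snd x.

Definition vector_field (lambda : R) (x : state) : state :=
  let S := S_coord x in
  let U := U_coord x in
  let P := P_coord x in
  ( - (1 / (3 * sqrt 3)) - 2 / 3 * S + 1 / sqrt 3 * S ^ 2 + 1 / sqrt 3 * U ^ 2
      + 1 / (2 * sqrt 3) * P ^ 2 + 2 * S ^ 3 - S * U ^ 2 + S * P ^ 2,
    U * (1 / 3 - lambda / 2 * P + 2 * S ^ 2 - U ^ 2 + P ^ 2),
    - (2 / 3) * P + lambda * U ^ 2 + 2 * S ^ 2 * P - U ^ 2 * P + P ^ 3 ).

Definition bianchiI_surface (x : state) : Prop :=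
  S_coord x ^ 2 + U_coord x ^ 2 + 1 / 2 * P_coord x ^ 2 = 1 / 3.

Definition P2 (lambda : R) : state :=
  (0, sqrt ((6 - lambda ^ 2) / 18), lambda / 3).

(* The expansion-normalized variables (S, U, P) of the physical quantities
   theta, sigma, psi, V, i.e. sigma = S theta, sqrt V = U theta, psi = P theta. *)
Definition normalized (theta sigma psi V : R -> R) (t : R) : state :=
  (sigma t / theta t, sqrt (V t) / theta t, psi t / theta t).

(* Solutions in cosmic time t of the Einstein-Klein-Gordon system with
   potential V0 exp (- lambda phi), psi = dphi/dt, theta > 0.  Since
   d/dtau = (1 / theta) d/dt, the system reads d/dt = theta * vector_field.  No separate
   evolution law for theta is needed: as V > 0 and dV/dt = - lambda psi V, the
   U-equation is equivalent to
   dtheta/dt = - theta^2 / 3 - 2 sigma^2 - psi^2 + V. *)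
Definition ekg_solution (lambda : R) (a b : Rbar) (theta sigma psi V : R -> R) : Prop :=
  (exists (V0 : R) (phi : R -> R), 0 < V0 /\
     forall t : R, in_interval a b t ->
       V t = V0 * exp (- lambda * phi t) /\ is_derive phi t (psi t)) /\
  (forall t : R, in_interval a b t ->
     0 < theta t /\
     is_derive (normalized theta sigma psi V) t
       (scal (theta t) (vector_field lambda (normalized theta sigma psi V t)))).

Definition bianchiI_solution (lambda : R) (a b : Rbar) (theta sigma psi V : R -> R) : Prop :=
  ekg_solution lambda a b theta sigma psi V /\
  forall t : R, in_interval a b t -> bianchiI_surface (normalized theta sigma psi V t).

Definition isotropizes (theta sigma : R -> R) : Prop :=
  is_lim (fun t => sigma t / theta t) p_infty 0.

Definition inflates (psi V : R -> R) (t : R) : Prop := psi t ^ 2 - V t < 0.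

Definition theta2 (lambda t : R) : R := 6 / (lambda ^ 2 * t).
Definition sigma2 (t : R) : R := 0.
Definition psi2 (lambda t : R) : R := 2 / (lambda * t).
Definition V2 (lambda t : R) : R := 2 * (6 - lambda ^ 2) / (lambda ^ 4 * t ^ 2).

(* Main.v *)
(** On the Bianchi I surface the system reduces to
    S' = - 3 U^2 S  and  (P - lambda/3)' = - 3 U^2 (P - lambda/3),  with U' a multiple of U,
    so S and P - lambda/3 shrink by the common factor exp (- 3 int U^2).  As long as they are
    small, U^2 = 1/3 - S^2 - P^2/2 stays close to its value (6 - lambda^2)/18 > 0 at P2; this
    gives exponential convergence.  In cosmic time the factor is exp (- 3 int theta U^2), and
    (1/theta)' = 3 S^2 + 3 P^2/2 <= 1 forces theta to decay at most like 1/t, so that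
    int theta = oo.  Since the direction of (S, P - lambda/3) is constant, existence of
    solutions reduces to a scalar separable equation. *)

Require Import Defs.
From Stdlib Require Import Reals Lra.
From Coquelicot Require Import Coquelicot.
Open Scope R_scope.

(** Both times are treated at once: an orbit carries a positive rate [h], which is 1 for tau and
    [theta] for t, and convergence only asks that the integral of [h] diverge. The common factor of
    S and P - lambda/3 is at most 1 everywhere on W, because U^2 >= 0. Smallness therefore persists
    without any continuity argument, and only afterwards is it converted into the lower bound on U^2
    that makes the decay exponential. W is symmetric under U -> -U and contains a mirror image of
    P2, so an estimate of U^2 controls U only once the sign of U is known to be conserved. Lyapunov
    stability as defined includes forward completeness on an interval with 0 in its interior.
    Solutions must thus be constructed, also slightly backwards in time, where the factor exceeds 1;
    hence existence is claimed on half the radius used for convergence. *)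

(** * Derivatives in products, intervals with extended endpoints, primitives *)

Lemma is_derive_pair {U V : NormedModule R_AbsRing} (f : R -> U) (g : R -> V)
    (t : R) (df : U) (dg : V) :
  is_derive f t df -> is_derive g t dg ->
  is_derive (fun s => (f s, g s)) t (df, dg).
Proof.
intros Hf Hg.
refine (filterdiff_comp'_2 f g (fun u v => (u, v)) t _ _ (fun u v => (u, v)) Hf Hg _).
apply filterdiff_ext with (fun z : prod_NormedModule R_AbsRing U V => z).
  now intros [u v].
apply filterdiff_ext_lin with (fun z : prod_NormedModule R_AbsRing U V => z).
  apply filterdiff_id.
now intros [u v].
Qed.

Lemma is_derive_fst {U V : NormedModule R_AbsRing}
    (x : R -> prod_NormedModule R_AbsRing U V) (t : R) (l : U * V) :
  is_derive x t l -> is_derive (fun s => fst (x s)) t (fst l).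
Proof.
intros H.
exact (filterdiff_comp' x (fun z : U * V => fst z) t _ _ H
  (filterdiff_linear (fun z : U * V => fst z) is_linear_fst)).
Qed.

Lemma is_derive_snd {U V : NormedModule R_AbsRing}
    (x : R -> prod_NormedModule R_AbsRing U V) (t : R) (l : U * V) :
  is_derive x t l -> is_derive (fun s => snd (x s)) t (snd l).
Proof.
intros H.
exact (filterdiff_comp' x (fun z : U * V => snd z) t _ _ H
  (filterdiff_linear (fun z : U * V => snd z) is_linear_snd)).
Qed.

Lemma is_derive_continuous (f : R -> R) (t l : R) : is_derive f t l -> continuous f t.
Proof. intros H; apply (ex_derive_continuous f); now exists l. Qed.

Lemma nonneg_derive_le (f df : R -> R) (a b : R) :
  a <= b ->
  (forall t, a <= t <= b -> is_derive f t (df t)) ->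
  (forall t, a <= t <= b -> 0 <= df t) ->
  f a <= f b.
Proof.
intros Hab Hd Hp.
destruct (MVT_gen f a b df) as [c [Hc Heq]].
- intros t Ht; rewrite Rmin_left, Rmax_right in Ht by lra; apply Hd; lra.
- intros t Ht; rewrite Rmin_left, Rmax_right in Ht by lra.
  apply continuity_pt_filterlim, (is_derive_continuous f t (df t)), Hd; lra.
- rewrite Rmin_left, Rmax_right in Hc by lra.
  specialize (Hp c ltac:(lra)); nra.
Qed.

Lemma in_interval_convex (a b : Rbar) (s t r : R) :
  in_interval a b s -> in_interval a b t -> Rmin s t <= r <= Rmax s t -> in_interval a b r.
Proof.
intros [Has Hsb] [Hat Htb] Hr; split.
- apply Rbar_lt_le_trans with (Rmin s t); [|simpl; lra].
  apply (Rmin_case s t (fun r => Rbar_lt a r)); auto.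
- apply Rbar_le_lt_trans with (Rmax s t); [simpl; lra|].
  apply (Rmax_case s t (fun r => Rbar_lt r b)); auto.
Qed.

Lemma in_interval_open (a b : Rbar) (t : R) :
  in_interval a b t -> locally t (in_interval a b).
Proof.
intros [Ha Hb]; apply filter_and.
- exact (open_Rbar_gt' t a Ha).
- exact (open_Rbar_lt' t b Hb).
Qed.

Lemma in_interval_ge (a b : Rbar) (t0 t : R) :
  Rbar_lt a t0 -> t0 <= t -> Rbar_lt t b -> in_interval a b t.
Proof.
intros Ha Ht Hb; split; auto.
apply Rbar_lt_le_trans with t0; simpl; auto.
Qed.

Lemma continuous_ex_RInt (a b : Rbar) (g : R -> R) (s t : R) :
  (forall r, in_interval a b r -> continuous g r) ->
  in_interval a b s -> in_interval a b t -> ex_RInt g s t.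
Proof.
intros Hg Hs Ht; apply (ex_RInt_continuous (V := R_CompleteNormedModule)).
intros z Hz; apply Hg; exact (in_interval_convex a b s t z Hs Ht Hz).
Qed.

Lemma continuous_is_derive_RInt (a b : Rbar) (g : R -> R) (t0 t : R) :
  (forall r, in_interval a b r -> continuous g r) ->
  in_interval a b t0 -> in_interval a b t ->
  is_derive (fun s => RInt g t0 s) t (g t).
Proof.
intros Hg H0 Ht.
apply (is_derive_RInt g (fun s => RInt g t0 s) t0 t); [|auto].
apply filter_imp with (2 := in_interval_open a b t Ht).
intros s Hs; apply (RInt_correct (V := R_CompleteNormedModule)).
exact (continuous_ex_RInt a b g t0 s Hg H0 Hs).
Qed.

(** * Scalar differential equations *)

(** Integrating factor. The exact formula preserves zero (invariance of W), sign (positivity of U)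
    and the ratio of two solutions with the same coefficient (S and P - lambda/3). *)
Lemma linear_ode_solution (a b : Rbar) (f g : R -> R) (t0 : R) :
  in_interval a b t0 ->
  (forall t, in_interval a b t -> continuous g t) ->
  (forall t, in_interval a b t -> is_derive f t (g t * f t)) ->
  forall t, in_interval a b t -> f t = f t0 * exp (RInt g t0 t).
Proof.
intros H0 Hg Hf t Ht.
set (D := fun s => f s * exp (- RInt g t0 s)).
assert (HD : forall s, in_interval a b s -> is_derive D s 0).
{ intros s Hs; unfold D.
  pose proof (continuous_is_derive_RInt a b g t0 s Hg H0 Hs) as HG.
  pose proof (Hf s Hs) as Hfs.
  evar_last.
  apply (is_derive_mult f (fun s => exp (- RInt g t0 s)) s); [exact Hfs| |exact Rmult_comm].
  apply (is_derive_comp exp (fun s => - RInt g t0 s)).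
    apply is_derive_exp.
  apply (is_derive_opp (fun s => RInt g t0 s)); exact HG.
  unfold plus, mult, scal, opp; simpl; unfold mult; simpl; ring. }
assert (Hc : D t = D t0).
{ destruct (Rtotal_order t t0) as [Hlt|[->|Hlt]]; [|reflexivity|].
  - apply (eq_is_derive (V := R_NormedModule) D t t0); [|exact Hlt].
    intros s Hs; apply HD, (in_interval_convex a b t t0); auto.
    rewrite Rmin_left, Rmax_right; lra.
  - symmetry; apply (eq_is_derive (V := R_NormedModule) D t0 t); [|exact Hlt].
    intros s Hs; apply HD, (in_interval_convex a b t0 t); auto.
    rewrite Rmin_left, Rmax_right; lra. }
unfold D in Hc; rewrite RInt_point in Hc.
change (@zero R_CompleteNormedModule) with 0 in Hc.
rewrite Ropp_0, exp_0, Rmult_1_r in Hc; rewrite <- Hc.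
rewrite Rmult_assoc, <- exp_plus, Rplus_opp_l, exp_0; ring.
Qed.

(* Separation of variables: [T] inverts the primitive [G] of [1 / k]. *)
Lemma autonomous_ode_exists (k : R -> R) (c M : R) :
  0 < c -> (forall y, continuous k y) -> (forall y, c <= k y <= M) ->
  exists T : R -> R, T 0 = 0 /\ (forall t, is_derive T t (k (T t))).
Proof.
intros Hc Hk Hb.
assert (Hk0 : forall y, 0 < k y) by (intros y; generalize (Hb y); lra).
set (G := fun y => RInt (fun r => / k r) 0 y).
assert (HG : forall y, is_derive G y (/ k y)).
{ intros y; apply (continuous_is_derive_RInt m_infty p_infty (fun r => / k r)); try easy.
  intros r _; apply (continuous_comp k Rinv); [apply Hk|].
  apply (is_derive_continuous Rinv (k r) (- 1 / (k r) ^ 2)).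
  auto_derive; [generalize (Hk0 r); lra|].
  field; generalize (Hk0 r); lra. }
assert (G0 : G 0 = 0) by (unfold G; now rewrite RInt_point).
assert (Hmv : forall u v, exists z, Rmin u v <= z <= Rmax u v /\ G v - G u = / k z * (v - u)).
{ intros u v; apply MVT_gen; intros; [apply HG|].
  apply continuity_pt_filterlim, (is_derive_continuous G _ _ (HG x)). }
assert (HM : 0 < M) by (generalize (Hb 0); lra).
assert (Hs : forall t, {y | G y = t}).
{ intros t.
  (* As [k <= M], the slope of [G] is at least [/ M], so at these endpoints [G] has passed
     [Rabs t + 1] in absolute value and [t] is attained in between. *)
  destruct (IVT_gen G (- (M * (Rabs t + 1))) (M * (Rabs t + 1)) t) as [y [_ Hy]].
  - intros y; apply continuity_pt_filterlim, (is_derive_continuous G _ _ (HG y)).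
  - assert (Hlow : forall u v, u <= v -> (v - u) / M <= G v - G u).
    { intros u v Huv; destruct (Hmv u v) as [z [_ Hz]]; rewrite Hz.
      unfold Rdiv; rewrite Rmult_comm; apply Rmult_le_compat_r; [lra|].
      apply Rinv_le_contravar; [apply Hk0|apply Hb]. }
    pose proof (Rabs_pos t).
    pose proof (Hlow (- (M * (Rabs t + 1))) 0 ltac:(nra)) as H1.
    pose proof (Hlow 0 (M * (Rabs t + 1)) ltac:(nra)) as H2.
    rewrite G0 in H1, H2.
    replace ((0 - - (M * (Rabs t + 1))) / M) with (Rabs t + 1) in H1 by (field; lra).
    replace ((M * (Rabs t + 1) - 0) / M) with (Rabs t + 1) in H2 by (field; lra).
    pose proof (Rle_abs t); pose proof (Rle_abs (- t)) as H3; rewrite Rabs_Ropp in H3.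
    rewrite Rmin_left, Rmax_right by lra; lra.
  - now exists y. }
set (T := fun t => proj1_sig (Hs t)).
assert (HT : forall t, G (T t) = t) by (intros t; exact (proj2_sig (Hs t))).
assert (Hdiff : forall s t, exists z,
  Rmin (T s) (T t) <= z <= Rmax (T s) (T t) /\ T t - T s = k z * (t - s)).
{ intros s t; destruct (Hmv (T s) (T t)) as [z [Hz Heq]].
  exists z; split; [exact Hz|].
  rewrite !HT in Heq; rewrite Heq; field; generalize (Hk0 z); lra. }
exists T; split.
- destruct (Hmv 0 (T 0)) as [z [_ Hz]].
  rewrite HT, G0 in Hz.
  pose proof (Rinv_0_lt_compat _ (Hk0 z)); nra.
- intros t; apply is_derive_Reals; intros eps Heps.
  assert (Hkc : continuity_pt k (T t)) by apply continuity_pt_filterlim, Hk.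
  destruct (Hkc eps Heps) as [d [Hd Hkd]]; simpl in Hkd; unfold R_dist in Hkd.
  (* [T] is Lipschitz with constant [M], so an increment below [d / M] keeps the intermediate point
     [z] within [d] of [T t]; the difference quotient is exactly [k z]. *)
  assert (HdM : 0 < d / M) by now apply Rdiv_lt_0_compat.
  exists (mkposreal _ HdM); intros h Hh0 Hh; simpl in Hh.
  destruct (Hdiff t (t + h)) as [z [Hz Heq]].
  rewrite Heq; replace (k z * (t + h - t) / h) with (k z) by now field.
  (* [continuity_pt] only speaks of points distinct from [T t]. *)
  destruct (Req_dec z (T t)) as [->|Hne]; [now rewrite Rminus_diag, Rabs_R0|].
  apply Hkd; split; [split; [exact I|auto]|].
  apply Rle_lt_trans with (Rabs (T (t + h) - T t)).
  { unfold Rmin, Rmax in Hz; destruct Rle_dec; unfold Rabs; do 2 destruct Rcase_abs; lra. }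
  rewrite Heq; replace (t + h - t) with h by ring; rewrite Rabs_mult.
  rewrite (Rabs_pos_eq (k z)) by (generalize (Hk0 z); lra).
  apply Rle_lt_trans with (M * Rabs h).
    apply Rmult_le_compat_r; [apply Rabs_pos|apply Hb].
  apply (Rmult_lt_compat_l M) in Hh; [|exact HM].
  now replace (M * (d / M)) with d in Hh by (field; lra).
Qed.

(** * The Euclidean distance in coordinates *)

Lemma euclidean_distE (x y : state) :
  euclidean_dist x y =
  sqrt ((S_coord x - S_coord y) ^ 2 + (U_coord x - U_coord y) ^ 2
        + (P_coord x - P_coord y) ^ 2).
Proof.
destruct x as [[S U] P], y as [[S' U'] P'].
unfold euclidean_dist, S_coord, U_coord, P_coord; simpl fst; simpl snd.
change (sqrt ((sqrt (Rabs (S - S') ^ 2 + Rabs (U - U') ^ 2)) ^ 2 + Rabs (P - P') ^ 2)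
  = sqrt ((S - S') ^ 2 + (U - U') ^ 2 + (P - P') ^ 2)).
rewrite pow2_sqrt by (pose proof (pow2_ge_0 (Rabs (S - S')));
  pose proof (pow2_ge_0 (Rabs (U - U'))); lra).
now rewrite !pow2_abs.
Qed.

Lemma coord_le_euclidean_dist (x y : state) :
  Rabs (S_coord x - S_coord y) <= euclidean_dist x y /\
  Rabs (U_coord x - U_coord y) <= euclidean_dist x y /\
  Rabs (P_coord x - P_coord y) <= euclidean_dist x y.
Proof.
rewrite euclidean_distE.
pose proof (pow2_ge_0 (S_coord x - S_coord y)).
pose proof (pow2_ge_0 (U_coord x - U_coord y)).
pose proof (pow2_ge_0 (P_coord x - P_coord y)).
repeat split; rewrite <- sqrt_Rsqr_abs; apply sqrt_le_1_alt; rewrite Rsqr_pow2; lra.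
Qed.

Lemma euclidean_dist_le_coords (x y : state) :
  euclidean_dist x y <=
  Rabs (S_coord x - S_coord y) + Rabs (U_coord x - U_coord y)
  + Rabs (P_coord x - P_coord y).
Proof.
rewrite euclidean_distE.
rewrite <- (pow2_abs (S_coord x - _)), <- (pow2_abs (U_coord x - _)),
  <- (pow2_abs (P_coord x - _)).
generalize (Rabs_pos (S_coord x - S_coord y)), (Rabs_pos (U_coord x - U_coord y)),
  (Rabs_pos (P_coord x - P_coord y)).
generalize (Rabs (S_coord x - S_coord y)), (Rabs (U_coord x - U_coord y)),
  (Rabs (P_coord x - P_coord y)).
intros p q r Hp Hq Hr.
apply Rle_trans with (sqrt ((p + q + r) ^ 2)); [apply sqrt_le_1_alt; nra|].
rewrite sqrt_pow2; lra.
Qed.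

Lemma is_derive_coords (x : R -> state) (t : R) (v : state) :
  is_derive x t v ->
  is_derive (fun s => S_coord (x s)) t (S_coord v) /\
  is_derive (fun s => U_coord (x s)) t (U_coord v) /\
  is_derive (fun s => P_coord (x s)) t (P_coord v).
Proof.
intros H; pose proof (is_derive_fst x t v H) as Hf.
split; [|split].
- exact (is_derive_fst _ t _ Hf).
- exact (is_derive_snd _ t _ Hf).
- exact (is_derive_snd x t v H).
Qed.

(** * Invariance of W and the reduced vector field *)

(** The defect [F] of the equation of W obeys the homogeneous linear equation F' = g F, so it
    vanishes identically once it vanishes at [t0]. *)
Lemma bianchiI_invariant (lambda : R) : invariant (vector_field lambda) bianchiI_surface.
Proof.
intros a b x t0 Hx H0 HW t Ht.
pose (S := fun s => S_coord (x s)).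
pose (U := fun s => U_coord (x s)).
pose (P := fun s => P_coord (x s)).
set (F := fun s => S s ^ 2 + U s ^ 2 + 1 / 2 * P s ^ 2 - 1 / 3).
set (g := fun s => 2 / sqrt 3 * S s + 2 * (2 * S s ^ 2 - U s ^ 2 + P s ^ 2)).
pose proof (sqrt_lt_R0 3 ltac:(lra)) as Hs3.
assert (HF : F t = F t0 * exp (RInt g t0 t)).
{ apply (linear_ode_solution a b); auto; intros s Hs;
    destruct (is_derive_coords x s _ (Hx s Hs)) as [HS [HU HP]];
    change (is_derive S s (S_coord (vector_field lambda (x s)))) in HS;
    change (is_derive U s (U_coord (vector_field lambda (x s)))) in HU;
    change (is_derive P s (P_coord (vector_field lambda (x s)))) in HP.
  - assert (Hg : ex_derive g s).
    { unfold g; auto_derive; repeat split; eexists; eassumption. }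
    now apply (ex_derive_continuous (V := R_NormedModule) g).
  - unfold F; auto_derive; [repeat split; eexists; eassumption|].
    change (fun s => S s) with S; change (fun s => U s) with U; change (fun s => P s) with P.
    rewrite (is_derive_unique S _ _ HS), (is_derive_unique U _ _ HU),
      (is_derive_unique P _ _ HP).
    unfold g, S, U, P, vector_field, S_coord, U_coord, P_coord; simpl fst; simpl snd.
    field; lra. }
unfold F, S, U, P in HF; unfold bianchiI_surface in *.
rewrite HW, Rminus_diag, Rmult_0_l in HF; lra.
Qed.

(** On W the terms with a factor 1/sqrt 3 cancel, and 2 S^2 + P^2 = 2/3 - 2 U^2 turns the common
    coefficient 2 S^2 - U^2 + P^2 - 2/3 into -3 U^2. *)
Lemma vector_field_bianchiI (lambda S U P : R) :
  bianchiI_surface (S, U, P) ->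
  vector_field lambda (S, U, P) =
  (- 3 * U ^ 2 * S, (3 * S ^ 2 + 3 / 2 * P ^ 2 - lambda / 2 * P) * U,
   - 3 * U ^ 2 * (P - lambda / 3)).
Proof.
unfold bianchiI_surface, vector_field, S_coord, U_coord, P_coord; simpl fst; simpl snd.
intros HW; pose proof (sqrt_lt_R0 3 ltac:(lra)) as Hs3.
assert (H1 : - (1 / (3 * sqrt 3)) + 1 / sqrt 3 * S ^ 2 + 1 / sqrt 3 * U ^ 2
   + 1 / (2 * sqrt 3) * P ^ 2 = 0).
{ replace (1 / (3 * sqrt 3)) with (1 / sqrt 3 * (1 / 3)) by (field; lra).
  rewrite <- HW; field; lra. }
assert (HU : U ^ 2 = 1 / 3 - S ^ 2 - 1 / 2 * P ^ 2) by lra.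
apply f_equal2; [apply f_equal2|].
- transitivity (- (1 / (3 * sqrt 3)) + 1 / sqrt 3 * S ^ 2 + 1 / sqrt 3 * U ^ 2
    + 1 / (2 * sqrt 3) * P ^ 2 + S * (2 * S ^ 2 - U ^ 2 + P ^ 2 - 2 / 3)); [field; lra|].
  rewrite H1, HU; field.
- rewrite HU; field.
- rewrite HU; field.
Qed.

(* With [h = 1] this is a solution in the time tau, with [h = theta] one in cosmic time. *)
Definition bianchiI_orbit (lambda : R) (a b : Rbar) (h : R -> R) (x : R -> state) : Prop :=
  forall t, in_interval a b t ->
    continuous h t /\ 0 < h t /\ bianchiI_surface (x t) /\
    is_derive x t (scal (h t) (vector_field lambda (x t))).

(** * Sign of U and contraction along orbits *)

Lemma orbit_derive_coords (lambda : R) (a b : Rbar) (h : R -> R) (x : R -> state) (t : R) :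
  bianchiI_orbit lambda a b h x ->
  in_interval a b t ->
  is_derive (fun s => S_coord (x s)) t (h t * (- 3 * U_coord (x t) ^ 2) * S_coord (x t)) /\
  is_derive (fun s => U_coord (x s)) t
    (h t * (3 * S_coord (x t) ^ 2 + 3 / 2 * P_coord (x t) ^ 2 - lambda / 2 * P_coord (x t))
     * U_coord (x t)) /\
  is_derive (fun s => P_coord (x s) - lambda / 3) t
    (h t * (- 3 * U_coord (x t) ^ 2) * (P_coord (x t) - lambda / 3)).
Proof.
intros Hx Ht; destruct (Hx t Ht) as [_ [_ [HW Hd]]].
assert (Hv : vector_field lambda (x t) =
  (- 3 * U_coord (x t) ^ 2 * S_coord (x t),
   (3 * S_coord (x t) ^ 2 + 3 / 2 * P_coord (x t) ^ 2 - lambda / 2 * P_coord (x t))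
     * U_coord (x t),
   - 3 * U_coord (x t) ^ 2 * (P_coord (x t) - lambda / 3))).
{ destruct (x t) as [[S U] P]; now apply vector_field_bianchiI. }
rewrite Hv in Hd; destruct (is_derive_coords x t _ Hd) as [HS [HU HP]].
split; [|split].
- evar_last; [exact HS|].
  unfold S_coord at 1; simpl; unfold scal; simpl; unfold mult; simpl; ring.
- evar_last; [exact HU|].
  unfold U_coord at 1; simpl; unfold scal; simpl; unfold mult; simpl; ring.
- evar_last.
    apply (is_derive_minus (fun s => P_coord (x s)) (fun _ => lambda / 3)); [exact HP|].
    apply (is_derive_const (V := R_NormedModule)).
  unfold P_coord at 1; simpl; unfold scal, minus, plus, opp, zero; simpl;
  unfold mult; simpl; ring.
Qed.

Lemma orbit_ex_derive_coords (lambda : R) (a b : Rbar) (h : R -> R) (x : R -> state) (t : R) :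
  bianchiI_orbit lambda a b h x -> in_interval a b t ->
  ex_derive (fun s : R => S_coord (x s)) t /\ ex_derive (fun s : R => U_coord (x s)) t /\
  ex_derive (fun s : R => P_coord (x s)) t.
Proof.
intros Hx Ht; destruct (Hx t Ht) as [_ [_ [_ Hd]]].
destruct (is_derive_coords x t _ Hd) as [HS [HU HP]].
split; [|split]; eexists; eassumption.
Qed.

Lemma orbit_U_pos (lambda : R) (a b : Rbar) (h : R -> R) (x : R -> state)
    (t0 t : R) :
  bianchiI_orbit lambda a b h x ->
  in_interval a b t0 -> in_interval a b t ->
  0 < U_coord (x t0) -> 0 < U_coord (x t).
Proof.
intros Hx H0 Ht HU.
rewrite (linear_ode_solution a b (fun s => U_coord (x s))
  (fun s => h s * (3 * S_coord (x s) ^ 2 + 3 / 2 * P_coord (x s) ^ 2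
    - lambda / 2 * P_coord (x s))) t0); auto.
- apply Rmult_lt_0_compat; [exact HU|apply exp_pos].
- intros s Hs; destruct (orbit_ex_derive_coords lambda a b h x s Hx Hs) as [HS [_ HP]].
  apply (continuous_mult (K := R_AbsRing) h); [apply (Hx s Hs)|].
  pose (S := fun s => S_coord (x s)); pose (P := fun s => P_coord (x s)).
  assert (Hk : ex_derive (fun s => 3 * S s ^ 2 + 3 / 2 * P s ^ 2 - lambda / 2 * P s) s).
  { auto_derive; repeat split; assumption. }
  exact (ex_derive_continuous (V := R_NormedModule) _ s Hk).
- intros s Hs; apply (orbit_derive_coords lambda a b h x s Hx Hs).
Qed.

(** Both quantities solve f' = g f with g = -3 h U^2, hence share the factor [m]. The bound [c] is
    left free: 0 gives non-expansion, a positive value gives decay. *)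
Lemma orbit_contraction (lambda : R) (a b : Rbar) (h : R -> R) (x : R -> state)
    (c t0 t : R) :
  bianchiI_orbit lambda a b h x ->
  in_interval a b t0 -> in_interval a b t -> t0 <= t ->
  (forall s, t0 <= s <= t -> c <= U_coord (x s) ^ 2) ->
  exists m, 0 < m <= exp (- 3 * c * RInt h t0 t) /\
    S_coord (x t) = m * S_coord (x t0) /\
    P_coord (x t) - lambda / 3 = m * (P_coord (x t0) - lambda / 3).
Proof.
intros Hx H0 Ht Hle Hc.
set (g := fun s => h s * (- 3 * U_coord (x s) ^ 2)).
assert (Hg : forall s, in_interval a b s -> continuous g s).
{ intros s Hs; destruct (orbit_ex_derive_coords lambda a b h x s Hx Hs) as [_ [HU _]].
  apply (continuous_mult (K := R_AbsRing) h); [apply (Hx s Hs)|].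
  pose (U := fun s => U_coord (x s)).
  assert (Hk : ex_derive (fun s => - 3 * U s ^ 2) s) by (auto_derive; repeat split; assumption).
  exact (ex_derive_continuous (V := R_NormedModule) _ s Hk). }
assert (Hh : forall s, in_interval a b s -> continuous h s) by (intros s Hs; apply (Hx s Hs)).
exists (exp (RInt g t0 t)); split; [split|split].
- apply exp_pos.
- assert (Hle' : RInt g t0 t <= - 3 * c * RInt h t0 t).
  { assert (Hs : RInt (fun s => - 3 * c * h s) t0 t = - 3 * c * RInt h t0 t).
    { apply (RInt_scal (V := R_CompleteNormedModule) h t0 t (- 3 * c)).
      now apply (continuous_ex_RInt a b). }
    rewrite <- Hs; apply RInt_le; auto.
    - now apply (continuous_ex_RInt a b).
    - apply (ex_RInt_scal (V := R_NormedModule)); now apply (continuous_ex_RInt a b).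
    - intros s Hts; unfold g.
      assert (Hi : in_interval a b s).
      { apply (in_interval_convex a b t0 t); auto; rewrite Rmin_left, Rmax_right; lra. }
      destruct (Hx s Hi) as [_ [Hp _]].
      specialize (Hc s ltac:(lra)); nra. }
  destruct Hle' as [Hlt| ->]; [|right; reflexivity].
  left; now apply exp_increasing.
- rewrite Rmult_comm; apply (linear_ode_solution a b (fun s => S_coord (x s)) g); auto.
  intros s Hs; apply (orbit_derive_coords lambda a b h x s Hx Hs).
- rewrite Rmult_comm.
  apply (linear_ode_solution a b (fun s => P_coord (x s) - lambda / 3) g); auto.
  intros s Hs; apply (orbit_derive_coords lambda a b h x s Hx Hs).
Qed.

(** * Estimates on W near P2 *)

Lemma lambda_bounds (lambda : R) : 0 <= lambda < sqrt 6 -> lambda ^ 2 < 6 /\ lambda < 3.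
Proof.
intros [H0 H6].
assert (H : lambda ^ 2 < 6).
{ rewrite <- (pow2_sqrt 6) by lra; apply Rsqr_incrst_1 in H6; [|lra|apply sqrt_pos].
  rewrite <- !Rsqr_pow2; exact H6. }
split; nra.
Qed.

(** With Q = P - lambda/3 the deviation of U^2 is -(S^2 + lambda/3 Q + Q^2/2). Since lambda < 3 and
    d <= 1, the three terms are at most d, d and d/2; the constant 3 is a rounding. *)
Lemma U_sq_near_P2 (lambda d S P : R) :
  0 <= lambda < sqrt 6 -> d <= 1 -> Rabs S <= d -> Rabs (P - lambda / 3) <= d ->
  Rabs (1 / 3 - S ^ 2 - 1 / 2 * P ^ 2 - (6 - lambda ^ 2) / 18) <= 3 * d.
Proof.
intros Hl Hd HS HP; destruct (lambda_bounds lambda Hl) as [_ H3].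
set (Q := P - lambda / 3) in *.
replace (1 / 3 - S ^ 2 - 1 / 2 * P ^ 2 - (6 - lambda ^ 2) / 18)
  with (- (S ^ 2 + lambda / 3 * Q + 1 / 2 * Q ^ 2)) by (unfold Q; field).
rewrite Rabs_Ropp.
apply Rabs_le_between in HS; apply Rabs_le_between in HP.
apply Rabs_le; nra.
Qed.

(* Within this distance of [P2], [U] is positive and [U ^ 2] at least half its value at [P2]. *)
Definition basin_radius (lambda : R) : R :=
  Rmin (Rmin 1 ((6 - lambda ^ 2) / 18 / 6)) (sqrt ((6 - lambda ^ 2) / 18)).

Lemma basin_radius_bounds (lambda : R) :
  0 <= lambda < sqrt 6 ->
  0 < sqrt ((6 - lambda ^ 2) / 18) /\ 0 < basin_radius lambda /\ basin_radius lambda <= 1 /\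
  basin_radius lambda <= (6 - lambda ^ 2) / 18 / 6 /\
  basin_radius lambda <= sqrt ((6 - lambda ^ 2) / 18).
Proof.
intros Hl; destruct (lambda_bounds lambda Hl) as [H6 _].
assert (Hu : 0 < sqrt ((6 - lambda ^ 2) / 18)) by (apply sqrt_lt_R0; lra).
unfold basin_radius; repeat split; auto.
- repeat apply Rmin_glb_lt; lra.
- eapply Rle_trans; [apply Rmin_l|apply Rmin_l].
- eapply Rle_trans; [apply Rmin_l|apply Rmin_r].
- apply Rmin_r.
Qed.

(** Let u be the U-coordinate of P2. Then U^2 - u^2 = (U - u)(U + u) and U > 0 gives U + u >= u, so
    division costs a factor 1/u. *)
Lemma U_near_P2 (lambda d S U P : R) :
  0 <= lambda < sqrt 6 -> d <= 1 -> Rabs S <= d -> Rabs (P - lambda / 3) <= d ->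
  bianchiI_surface (S, U, P) -> 0 < U ->
  Rabs (U - sqrt ((6 - lambda ^ 2) / 18)) <= 3 / sqrt ((6 - lambda ^ 2) / 18) * d.
Proof.
intros Hl Hd HS HP HW HU; pose proof (U_sq_near_P2 lambda d S P Hl Hd HS HP) as H.
destruct (lambda_bounds lambda Hl) as [H6 _].
assert (Hu : 0 < sqrt ((6 - lambda ^ 2) / 18)) by (apply sqrt_lt_R0; lra).
assert (Hu2 : sqrt ((6 - lambda ^ 2) / 18) ^ 2 = (6 - lambda ^ 2) / 18) by (apply pow2_sqrt; lra).
set (u := sqrt ((6 - lambda ^ 2) / 18)) in *.
unfold bianchiI_surface, S_coord, U_coord, P_coord in HW; simpl fst in HW; simpl snd in HW.
replace (1 / 3 - S ^ 2 - 1 / 2 * P ^ 2 - (6 - lambda ^ 2) / 18) with ((U - u) * (U + u)) in H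
  by (rewrite <- Hu2; rewrite <- HW; ring).
rewrite Rabs_mult, (Rabs_pos_eq (U + u)) in H by lra.
apply (Rmult_le_reg_r u); [exact Hu|].
replace (3 / u * d * u) with (3 * d) by (field; lra).
pose proof (Rmult_le_pos _ _ (Rabs_pos (U - u)) (Rlt_le _ _ HU)); lra.
Qed.

Lemma P2_coords (lambda : R) :
  S_coord (P2 lambda) = 0 /\ U_coord (P2 lambda) = sqrt ((6 - lambda ^ 2) / 18) /\
  P_coord (P2 lambda) = lambda / 3.
Proof. split; [|split]; reflexivity. Qed.

Lemma P2_dist_coords (lambda : R) (x : state) :
  Rabs (S_coord x) <= euclidean_dist x (P2 lambda) /\
  Rabs (U_coord x - sqrt ((6 - lambda ^ 2) / 18)) <= euclidean_dist x (P2 lambda) /\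
  Rabs (P_coord x - lambda / 3) <= euclidean_dist x (P2 lambda).
Proof.
destruct (coord_le_euclidean_dist x (P2 lambda)) as [HS [HU HP]].
destruct (P2_coords lambda) as [ES [EU EP]].
rewrite ES, Rminus_0_r in HS; rewrite EU in HU; rewrite EP in HP; auto.
Qed.

Lemma P2_dist_le (lambda d : R) (x : state) :
  0 <= lambda < sqrt 6 -> d <= 1 -> bianchiI_surface x -> 0 < U_coord x ->
  Rabs (S_coord x) <= d -> Rabs (P_coord x - lambda / 3) <= d ->
  euclidean_dist x (P2 lambda) <= (2 + 3 / sqrt ((6 - lambda ^ 2) / 18)) * d.
Proof.
intros Hl Hd HW HU HS HP.
pose proof (euclidean_dist_le_coords x (P2 lambda)) as He.
destruct (P2_coords lambda) as [ES [EU EP]].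
rewrite ES, EU, EP, Rminus_0_r in He.
destruct x as [[S U] P].
pose proof (U_near_P2 lambda d S U P Hl Hd HS HP HW HU).
unfold S_coord, U_coord, P_coord in *; simpl fst in *; simpl snd in *; lra.
Qed.

Lemma basin_U_pos (lambda : R) (x : state) :
  euclidean_dist x (P2 lambda) < basin_radius lambda -> 0 < U_coord x.
Proof.
intros Hr; destruct (P2_dist_coords lambda x) as [_ [HU _]].
pose proof (Rmin_r (Rmin 1 ((6 - lambda ^ 2) / 18 / 6)) (sqrt ((6 - lambda ^ 2) / 18))) as Hb.
fold (basin_radius lambda) in Hb.
apply Rabs_le_between in HU; lra.
Qed.

(** Three times the radius is at most half of (6 - lambda^2)/18, which explains the division by 6 in
    [basin_radius]. *)
Lemma basin_U_sq (lambda S P : R) :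
  0 <= lambda < sqrt 6 -> Rabs S <= basin_radius lambda ->
  Rabs (P - lambda / 3) <= basin_radius lambda ->
  (6 - lambda ^ 2) / 36 <= 1 / 3 - S ^ 2 - 1 / 2 * P ^ 2.
Proof.
intros Hl HS HP.
destruct (basin_radius_bounds lambda Hl) as [_ [_ [H1 [H2 _]]]].
pose proof (U_sq_near_P2 lambda _ S P Hl H1 HS HP) as H.
apply Rabs_le_between in H; lra.
Qed.

(** * Stability and convergence of orbits for a general rate *)

Lemma orbit_in_basin (lambda : R) (a b : Rbar) (h : R -> R) (x : R -> state) (t0 t : R) :
  0 <= lambda < sqrt 6 ->
  bianchiI_orbit lambda a b h x ->
  in_interval a b t0 -> in_interval a b t -> t0 <= t ->
  euclidean_dist (x t0) (P2 lambda) < basin_radius lambda ->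
  0 < U_coord (x t) /\
  (exists m, 0 < m <= exp (- (6 - lambda ^ 2) / 12 * RInt h t0 t) /\
    S_coord (x t) = m * S_coord (x t0) /\
    P_coord (x t) - lambda / 3 = m * (P_coord (x t0) - lambda / 3)) /\
  Rabs (S_coord (x t)) <= euclidean_dist (x t0) (P2 lambda) /\
  Rabs (P_coord (x t) - lambda / 3) <= euclidean_dist (x t0) (P2 lambda) /\
  euclidean_dist (x t) (P2 lambda) <=
    (2 + 3 / sqrt ((6 - lambda ^ 2) / 18)) * euclidean_dist (x t0) (P2 lambda).
Proof.
intros Hl Hx H0 Ht Hle Hr.
destruct (P2_dist_coords lambda (x t0)) as [HS0 [_ HP0]].
assert (Hbound : forall s, in_interval a b s -> t0 <= s ->
  Rabs (S_coord (x s)) <= euclidean_dist (x t0) (P2 lambda) /\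
  Rabs (P_coord (x s) - lambda / 3) <= euclidean_dist (x t0) (P2 lambda)).
{ intros s Hs Hts.
  (* The choice [c = 0] presupposes nothing about the orbit, so the offsets stay within their
     initial bound; this then justifies the positive [c] in the second application. *)
  destruct (orbit_contraction lambda a b h x 0 t0 s Hx H0 Hs Hts) as [m [Hm [HS HP]]].
    intros r _; apply pow2_ge_0.
  rewrite Rmult_0_r, Rmult_0_l, exp_0 in Hm.
  rewrite HS, HP, !Rabs_mult, (Rabs_pos_eq m) by lra.
  pose proof (Rabs_pos (S_coord (x t0))).
  pose proof (Rabs_pos (P_coord (x t0) - lambda / 3)).
  split; nra. }
destruct (Hbound t Ht Hle) as [HS HP].
destruct (basin_radius_bounds lambda Hl) as [_ [_ [H1 _]]].
assert (HU : 0 < U_coord (x t)).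
{ apply (orbit_U_pos lambda a b h x t0 t Hx H0 Ht), (basin_U_pos lambda); exact Hr. }
split; [exact HU|split; [|split; [exact HS|split; [exact HP|]]]].
- destruct (orbit_contraction lambda a b h x ((6 - lambda ^ 2) / 36) t0 t Hx H0 Ht Hle)
    as [m [Hm Heq]].
  + intros s Hs.
    assert (Hi : in_interval a b s).
    { apply (in_interval_convex a b t0 t); auto; rewrite Rmin_left, Rmax_right; lra. }
    destruct (Hbound s Hi ltac:(lra)) as [HSs HPs].
    destruct (Hx s Hi) as [_ [_ [HW _]]]; unfold bianchiI_surface in HW.
    pose proof (basin_U_sq lambda (S_coord (x s)) (P_coord (x s)) Hl ltac:(lra) ltac:(lra)).
    lra.
  + exists m; split; [|exact Heq].
    now replace (- (6 - lambda ^ 2) / 12) with (- 3 * ((6 - lambda ^ 2) / 36)) by field.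
- apply P2_dist_le; auto; [lra|apply (Hx t Ht)].
Qed.

Lemma orbit_converges (lambda : R) (a : Rbar) (h : R -> R) (x : R -> state) (t0 : R) :
  0 <= lambda < sqrt 6 ->
  bianchiI_orbit lambda a p_infty h x -> Rbar_lt a t0 ->
  is_lim (fun t => RInt h t0 t) p_infty p_infty ->
  euclidean_dist (x t0) (P2 lambda) < basin_radius lambda ->
  forall eps, 0 < eps ->
  Rbar_locally p_infty (fun t => euclidean_dist (x t) (P2 lambda) < eps).
Proof.
intros Hl Hx Ha Hh Hr eps Heps.
destruct (lambda_bounds lambda Hl) as [H6 _].
destruct (basin_radius_bounds lambda Hl) as [Hu [_ [H1 _]]].
assert (HC : 0 < 3 / sqrt ((6 - lambda ^ 2) / 18)) by (apply Rdiv_lt_0_compat; lra).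
set (C := 3 / sqrt ((6 - lambda ^ 2) / 18)) in *.
assert (H0 : in_interval a p_infty t0) by (split; simpl; auto).
(* The cap 1 is required by [P2_dist_le]; the factor 2 makes the final inequality strict. *)
pose (d := Rmin 1 (eps / (2 * (2 + C)))).
assert (Hd : 0 < d) by (apply Rmin_glb_lt; [lra|apply Rdiv_lt_0_compat; lra]).
assert (Hlim : is_lim (fun t => exp (- (6 - lambda ^ 2) / 12 * RInt h t0 t)) p_infty 0).
{ apply (is_lim_comp exp _ p_infty 0 m_infty is_lim_exp_m).
  - replace m_infty with (Rbar_mult (- (6 - lambda ^ 2) / 12) p_infty).
      now apply is_lim_scal_l.
    simpl; destruct Rle_dec; [exfalso; lra|reflexivity].
  - now exists 0. }
apply is_lim_spec in Hlim; destruct (Hlim (mkposreal d Hd)) as [M HM].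
exists (Rmax M t0); intros t Ht.
pose proof (Rmax_l M t0); pose proof (Rmax_r M t0).
specialize (HM t ltac:(lra)); simpl in HM; rewrite Rminus_0_r in HM.
assert (Hi : in_interval a p_infty t) by (apply (in_interval_ge a p_infty t0 t); simpl; auto; lra).
destruct (orbit_in_basin lambda a p_infty h x t0 t Hl Hx H0 Hi ltac:(lra) Hr)
  as [HU [[m [Hm [HS HP]]] _]].
rewrite (Rabs_pos_eq (exp _)) in HM by apply Rlt_le, exp_pos.
assert (Hmd : m <= d) by (simpl in *; lra).
destruct (P2_dist_coords lambda (x t0)) as [HS0 [_ HP0]].
(* The initial offsets are below [basin_radius lambda <= 1], so [m <= d] alone puts those at [t]
   within [d]. *)
apply Rle_lt_trans with ((2 + C) * d).
- apply P2_dist_le; auto; [apply Rmin_l|apply (Hx t Hi)| |];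
    rewrite ?HS, ?HP, Rabs_mult, (Rabs_pos_eq m) by lra.
  + pose proof (Rabs_pos (S_coord (x t0))); nra.
  + pose proof (Rabs_pos (P_coord (x t0) - lambda / 3)); nra.
- assert (Hde : d <= eps / (2 * (2 + C))) by apply Rmin_r.
  apply (Rmult_le_compat_l (2 + C)) in Hde; [|lra].
  replace ((2 + C) * (eps / (2 * (2 + C)))) with (eps / 2) in Hde by (field; lra).
  lra.
Qed.

Lemma S_coord_lim (lambda : R) (x : R -> state) :
  (forall eps, 0 < eps ->
    Rbar_locally p_infty (fun t => euclidean_dist (x t) (P2 lambda) < eps)) ->
  is_lim (fun t => S_coord (x t)) p_infty 0.
Proof.
intros H; apply is_lim_spec; intros eps.
apply filter_imp with (2 := H eps (cond_pos eps)); intros t Ht.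
destruct (P2_dist_coords lambda (x t)) as [HS _].
rewrite Rminus_0_r; lra.
Qed.

(** Balls of the product uniform structure are boxes, so coordinatewise closeness is enough. *)
Lemma filterlim_euclidean_dist (x : R -> state) (p : state) :
  (forall eps, 0 < eps -> Rbar_locally p_infty (fun t => euclidean_dist (x t) p < eps)) ->
  filterlim x (Rbar_locally p_infty) (locally p).
Proof.
intros H; apply filterlim_locally; intros eps.
apply filter_imp with (2 := H eps (cond_pos eps)); intros t Ht.
destruct (coord_le_euclidean_dist (x t) p) as [HS [HU HP]].
split; [split|].
- exact (Rle_lt_trans _ _ _ HS Ht).
- exact (Rle_lt_trans _ _ _ HU Ht).
- exact (Rle_lt_trans _ _ _ HP Ht).
Qed.

(** * Solutions in the time tau: convergence and existence *)

Lemma solution_bianchiI_orbit (lambda : R) (a b : Rbar) (x : R -> state) :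
  solution_in (vector_field lambda) bianchiI_surface a b x ->
  bianchiI_orbit lambda a b (fun _ => 1) x.
Proof.
intros [Hx HW] t Ht; split; [apply continuous_const|split; [lra|split; [now apply HW|]]].
change 1 with (@one R_Ring); rewrite scal_one; now apply Hx.
Qed.

Lemma is_lim_RInt_one (t0 : R) : is_lim (fun t => RInt (fun _ => 1) t0 t) p_infty p_infty.
Proof.
apply is_lim_ext with (fun t => t - t0).
  intros t; rewrite RInt_const; unfold scal; simpl; unfold mult; simpl; ring.
apply is_lim_spec; intros M; exists (M + t0); intros t Ht; lra.
Qed.

Lemma solution_converges (lambda : R) (a : Rbar) (x : R -> state) :
  0 <= lambda < sqrt 6 -> Rbar_lt a 0 ->
  solution_in (vector_field lambda) bianchiI_surface a p_infty x ->
  euclidean_dist (x 0) (P2 lambda) < basin_radius lambda ->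
  forall eps, 0 < eps ->
  Rbar_locally p_infty (fun t => euclidean_dist (x t) (P2 lambda) < eps).
Proof.
intros Hl Ha Hx; apply (orbit_converges lambda a (fun _ => 1) x 0); auto.
- now apply solution_bianchiI_orbit.
- apply is_lim_RInt_one.
Qed.

Lemma bianchiI_solution_exists (lambda : R) (x0 : state) :
  0 <= lambda < sqrt 6 -> bianchiI_surface x0 ->
  euclidean_dist x0 (P2 lambda) < basin_radius lambda / 2 ->
  exists (a : Rbar) (x : R -> state),
    Rbar_lt a 0 /\ solution_in (vector_field lambda) bianchiI_surface a p_infty x /\ x 0 = x0.
Proof.
intros Hl HW Hr.
destruct (basin_radius_bounds lambda Hl) as [_ [Hr0 _]].
destruct (lambda_bounds lambda Hl) as [H6 _].
assert (HU0 : 0 < U_coord x0) by (apply (basin_U_pos lambda); lra).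
destruct (P2_dist_coords lambda x0) as [HS0 [_ HP0]].
destruct x0 as [[S0 U0] P0].
unfold bianchiI_surface, S_coord, U_coord, P_coord in *; simpl fst in *; simpl snd in *.
set (Q0 := P0 - lambda / 3) in *.
(* [K m] is the value of U^2 that W imposes when both offsets are scaled by [m]. The factor obeys m'
   = -3 K(m) m, and m = exp(-3 y) turns this into y' = K(m). *)
pose (K := fun m => 1 / 3 - (m * S0) ^ 2 - 1 / 2 * (lambda / 3 + m * Q0) ^ 2).
(* the minimum of [exp (- 3 * y)] and [2], which keeps the right-hand side positive for all [y] *)
pose (m := fun y => (exp (- 3 * y) + 2 - Rabs (exp (- 3 * y) - 2)) / 2).
assert (Hm : forall y, 0 <= m y <= 2).
{ intros y; unfold m; pose proof (exp_pos (- 3 * y)).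
  unfold Rabs; destruct Rcase_abs; lra. }
assert (Hme : forall y, - (ln 2 / 3) < y -> m y = exp (- 3 * y)).
{ intros y Hy; assert (He : exp (- 3 * y) < 2).
  { rewrite <- (exp_ln 2) by lra; apply exp_increasing; lra. }
  unfold m; rewrite Rabs_left by lra; field. }
(* Factors up to 2 at most double the offsets, which the half radius in the hypothesis allows. *)
assert (HK : forall z, 0 <= z <= 2 -> (6 - lambda ^ 2) / 36 <= K z).
{ intros z Hz; apply basin_U_sq; auto.
  - rewrite Rabs_mult, (Rabs_pos_eq z) by lra; pose proof (Rabs_pos S0); nra.
  - replace (lambda / 3 + z * Q0 - lambda / 3) with (z * Q0) by ring.
    rewrite Rabs_mult, (Rabs_pos_eq z) by lra; pose proof (Rabs_pos Q0); nra. }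
destruct (autonomous_ode_exists (fun y => K (m y)) ((6 - lambda ^ 2) / 36) (1 / 3))
  as [T [T0 HT]].
- lra.
- intros y; apply (continuous_comp m K).
  + assert (He : continuous (fun z => exp (- 3 * z)) y).
    { apply (is_derive_continuous _ y (- 3 * exp (- 3 * y))); auto_derive; [easy|ring]. }
    apply (continuous_mult (K := R_AbsRing) (fun z => exp (- 3 * z) + 2 - Rabs (exp (- 3 * z) - 2))
      (fun _ => / 2)); [|apply continuous_const].
    apply (continuous_minus (V := R_NormedModule) (fun z => exp (- 3 * z) + 2)).
      apply (continuous_plus (V := R_NormedModule)); [exact He|apply continuous_const].
    apply (continuous_Rabs_comp (fun z => exp (- 3 * z) - 2)).
    apply (continuous_minus (V := R_NormedModule)); [exact He|apply continuous_const].
  + assert (Hk : ex_derive K (m y)) by (unfold K; auto_derive; easy).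
    exact (ex_derive_continuous (V := R_NormedModule) K _ Hk).
- intros y; split; [apply HK, Hm|].
  unfold K; pose proof (pow2_ge_0 (m y * S0)); pose proof (pow2_ge_0 (lambda / 3 + m y * Q0)).
  lra.
(* As [T 0 = 0] and the slope of [T] is at most 1/3, T t >= t/3 for negative t. So after time
   [- ln 2] the truncated factor is the true exponential. *)
- assert (HTa : forall t, - ln 2 < t -> - (ln 2 / 3) < T t).
  { intros t Ht; pose proof ln_lt_2.
    assert (HkM : forall s, 0 <= K (m (T s)) <= 1 / 3).
    { intros s; pose proof (HK _ (Hm (T s))).
      pose proof (pow2_ge_0 (m (T s) * S0)).
      pose proof (pow2_ge_0 (lambda / 3 + m (T s) * Q0)); unfold K in *; lra. }
    destruct (Rle_lt_dec 0 t) as [H0|H0].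
    - pose proof (nonneg_derive_le T (fun s => K (m (T s))) 0 t H0
        ltac:(intros; apply HT) ltac:(intros s _; apply HkM)).
      lra.
    - assert (Hle : t / 3 - T t <= 0 / 3 - T 0); [|lra].
      apply (nonneg_derive_le (fun s => s / 3 - T s) (fun s => 1 / 3 - K (m (T s)))); [lra| |].
      + intros s _; apply (is_derive_minus (fun s => s / 3) T); [|apply HT].
        auto_derive; [easy|lra].
      + intros s _; pose proof (HkM s); lra. }
  pose (E := fun t => exp (- 3 * T t)).
  assert (HEm : forall t, - ln 2 < t -> m (T t) = E t) by (intros t Ht; apply Hme, HTa, Ht).
  assert (HKE : forall t, - ln 2 < t -> 0 < K (E t)).
  { intros t Ht; rewrite <- HEm by exact Ht; pose proof (HK _ (Hm (T t))); lra. }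
  assert (HE : forall t, - ln 2 < t -> is_derive E t (- 3 * K (E t) * E t)).
  { intros t Ht; evar_last.
      apply (is_derive_comp exp (fun s => - 3 * T s)); [apply is_derive_exp|].
      apply (is_derive_scal T); exact (HT t).
    rewrite HEm by exact Ht; unfold E, scal; simpl; unfold mult; simpl; ring. }
  assert (HWx : forall t, - ln 2 < t ->
    bianchiI_surface (E t * S0, sqrt (K (E t)), lambda / 3 + E t * Q0)).
  { intros t Ht; unfold bianchiI_surface, S_coord, U_coord, P_coord; simpl fst; simpl snd.
    rewrite pow2_sqrt by (apply Rlt_le, HKE, Ht); unfold K; ring. }
  exists (- ln 2), (fun t => (E t * S0, sqrt (K (E t)), lambda / 3 + E t * Q0)).
  split; [|split; [split|]].
  + simpl; pose proof ln_lt_2; lra.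
  + intros t [Ht _]; simpl in Ht.
    rewrite (vector_field_bianchiI _ _ _ _ (HWx t Ht)).
    pose proof (HE t Ht) as Hd; pose proof (HKE t Ht) as Hp.
    pose proof (sqrt_lt_R0 _ Hp) as Hs.
    rewrite !pow2_sqrt by lra.
    assert (Hex : ex_derive E t) by (eexists; exact Hd).
    assert (HdS : is_derive (fun s => E s * S0) t (- 3 * K (E t) * (E t * S0))).
    { auto_derive; [exact Hex|].
      change (fun s => E s) with E; rewrite (is_derive_unique E _ _ Hd); ring. }
    assert (HdU : is_derive (fun s => sqrt (K (E s))) t
      ((3 * (E t * S0) ^ 2 + 3 / 2 * (lambda / 3 + E t * Q0) ^ 2
        - lambda / 2 * (lambda / 3 + E t * Q0)) * sqrt (K (E t)))).
    { unfold K at 1; auto_derive.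
        split; [exact Hex|split; [exact Hex|split; [exact Hp|exact I]]].
      change (fun s => E s) with E; rewrite (is_derive_unique E _ _ Hd).
      match goal with |- context [sqrt ?y] => change y with (K (E t)) end.
      (* The numerator contains U^2 through the derivative of [E]; writing it as a square of the
         root cancels the root in the denominator. *)
      rewrite <- (sqrt_sqrt (K (E t))) at 1 2 by lra.
      field; lra. }
    assert (HdP : is_derive (fun s => lambda / 3 + E s * Q0) t
      (- 3 * K (E t) * (lambda / 3 + E t * Q0 - lambda / 3))).
    { auto_derive; [exact Hex|].
      change (fun s => E s) with E; rewrite (is_derive_unique E _ _ Hd); ring. }
    exact (is_derive_pair _ _ t _ _ (is_derive_pair _ _ t _ _ HdS HdU) HdP).
  + intros t [Ht _]; now apply HWx.
  + unfold E; rewrite T0, Rmult_0_r, exp_0, !Rmult_1_l.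
    f_equal; [f_equal|unfold Q0; ring].
    (* This is the membership of the initial point in W; [U0 > 0] then selects the positive root. *)
    replace (K 1) with (U0 ^ 2) by (unfold K, Q0; lra).
    apply sqrt_pow2; lra.
Qed.

(** * The critical point P2 and its asymptotic stability *)

Lemma bianchiI_P2 (lambda : R) : 0 <= lambda < sqrt 6 -> bianchiI_surface (P2 lambda).
Proof.
intros Hl; destruct (lambda_bounds lambda Hl) as [H6 _].
unfold bianchiI_surface; destruct (P2_coords lambda) as [-> [-> ->]].
rewrite pow2_sqrt by lra; field.
Qed.

Lemma vector_field_P2 (lambda : R) :
  0 <= lambda < sqrt 6 -> vector_field lambda (P2 lambda) = (0, 0, 0).
Proof.
intros Hl; unfold P2; rewrite vector_field_bianchiI by now apply bianchiI_P2.
apply f_equal2; [apply f_equal2|]; field.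
Qed.

Lemma P2_lyapunov_stable (lambda : R) :
  0 <= lambda < sqrt 6 -> lyapunov_stable (vector_field lambda) bianchiI_surface (P2 lambda).
Proof.
intros Hl eps Heps.
destruct (basin_radius_bounds lambda Hl) as [Hu [Hr _]].
assert (HC : 0 < 3 / sqrt ((6 - lambda ^ 2) / 18)) by (apply Rdiv_lt_0_compat; lra).
pose (C := 2 + 3 / sqrt ((6 - lambda ^ 2) / 18)).
exists (Rmin (basin_radius lambda / 2) (eps / C)); split.
  apply Rmin_glb_lt; [lra|apply Rdiv_lt_0_compat; unfold C; lra].
intros x0 HW Hx0.
pose proof (Rlt_le_trans _ _ _ Hx0 (Rmin_l _ _)) as H1.
pose proof (Rlt_le_trans _ _ _ Hx0 (Rmin_r _ _)) as H2.
split; [now apply bianchiI_solution_exists|].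
intros a b x H0 Hx Hx00 t Ht Htb.
apply solution_bianchiI_orbit in Hx.
rewrite <- Hx00 in H1, H2.
assert (Hi : in_interval a b t) by (apply (in_interval_ge a b 0 t); auto; apply H0).
destruct (orbit_in_basin lambda a b _ x 0 t Hl Hx H0 Hi Ht ltac:(lra)) as [_ [_ [_ [_ Hd]]]].
fold C in Hd; apply Rle_lt_trans with (1 := Hd).
apply (Rmult_lt_compat_l C) in H2; [|unfold C; lra].
now replace (C * (eps / C)) with eps in H2 by (field; unfold C; lra).
Qed.

Lemma P2_attractive (lambda : R) :
  0 <= lambda < sqrt 6 -> attractive (vector_field lambda) bianchiI_surface (P2 lambda).
Proof.
intros Hl; exists (basin_radius lambda); split; [apply (basin_radius_bounds lambda Hl)|].
intros a x Ha Hx Hr; apply filterlim_euclidean_dist.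
now apply (solution_converges lambda a).
Qed.

(** * Cosmic time: evolution of the expansion and isotropization *)

Lemma potential_pos (lambda : R) (a b : Rbar) (theta sigma psi V : R -> R) (t : R) :
  ekg_solution lambda a b theta sigma psi V -> in_interval a b t -> 0 < V t.
Proof.
intros [[V0 [phi [HV0 Hphi]]] _] Ht; rewrite (proj1 (Hphi t Ht)).
apply Rmult_lt_0_compat; [exact HV0|apply exp_pos].
Qed.

(* The evolution law of the expansion, read off the [U]-equation through [1 / theta = U / sqrt V]. *)
Lemma is_derive_inv_theta (lambda : R) (a b : Rbar) (theta sigma psi V : R -> R) (t : R) :
  ekg_solution lambda a b theta sigma psi V -> in_interval a b t ->
  let x := normalized theta sigma psi V in
  is_derive (fun s => / theta s) t
    (1 / 3 + 2 * S_coord (x t) ^ 2 - U_coord (x t) ^ 2 + P_coord (x t) ^ 2).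
Proof.
intros H Ht x.
assert (HVp : forall s, in_interval a b s -> 0 < V s)
  by (intros s; now apply (potential_pos lambda a b theta sigma psi)).
destruct H as [[V0 [phi [HV0 Hphi]]] Hx].
destruct (Hx t Ht) as [Hth Hd].
destruct (is_derive_coords _ _ _ Hd) as [_ [HU _]].
set (U := fun s => U_coord (normalized theta sigma psi V s)) in HU.
destruct (Hphi t Ht) as [HVt Hphit].
assert (HsV : 0 < sqrt (V t)) by now apply sqrt_lt_R0, HVp.
(* Only U and [phi] are known to be differentiable, so [/ theta] is expressed through them near
   [t]. *)
apply is_derive_ext_loc with (fun s => U s / sqrt (V0 * exp (- lambda * phi s))).
{ apply filter_imp with (2 := in_interval_open a b t Ht); intros s Hs.
  rewrite <- (proj1 (Hphi s Hs)); unfold U, U_coord, normalized; simpl.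
  destruct (Hx s Hs) as [Hths _].
  assert (0 < sqrt (V s)) by now apply sqrt_lt_R0, HVp.
  field; lra. }
assert (HexU : ex_derive U t) by (eexists; exact HU).
assert (Hexphi : ex_derive phi t) by (eexists; exact Hphit).
assert (Hp : 0 < V0 * exp (- lambda * phi t)) by (rewrite <- HVt; now apply HVp).
auto_derive.
  repeat split; auto; rewrite <- HVt; lra.
change (fun s => U s) with U; change (fun s => phi s) with phi.
rewrite (is_derive_unique U _ _ HU), (is_derive_unique phi _ _ Hphit), <- HVt.
(* This is V' = -lambda psi V; its contribution cancels the term lambda/2 P of the U-equation. *)
replace (V0 * (- lambda * (1 * psi t) * exp (- lambda * phi t)))
  with (- lambda * psi t * (sqrt (V t) * sqrt (V t)))
  by (rewrite sqrt_sqrt by lra; rewrite HVt; ring).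
unfold U, x, normalized, vector_field, S_coord, U_coord, P_coord; simpl fst; simpl snd.
unfold scal; simpl; unfold mult; simpl.
field; lra.
Qed.

(** The point is the continuity of the rate [theta], inherited from the differentiability of its
    reciprocal. *)
Lemma bianchiI_solution_orbit (lambda : R) (a b : Rbar) (theta sigma psi V : R -> R) :
  bianchiI_solution lambda a b theta sigma psi V ->
  bianchiI_orbit lambda a b theta (normalized theta sigma psi V).
Proof.
intros [H HW] t Ht; pose proof (is_derive_inv_theta lambda a b theta sigma psi V t H Ht) as Hd.
destruct H as [_ Hx]; destruct (Hx t Ht) as [Hth Hdx].
split; [|split; [exact Hth|split; [now apply HW|exact Hdx]]].
apply continuous_ext with (fun s => / / theta s); [intros s; apply Rinv_inv|].
apply (continuous_comp (fun s => / theta s) Rinv).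
  exact (is_derive_continuous _ _ _ Hd).
apply continuity_pt_filterlim, continuity_pt_inv; [apply continuity_pt_id|].
apply Rinv_neq_0_compat; lra.
Qed.

Lemma is_lim_RInt_theta (lambda : R) (a : Rbar) (theta sigma psi V : R -> R) (t0 : R) :
  bianchiI_solution lambda a p_infty theta sigma psi V -> Rbar_lt a t0 ->
  is_lim (fun t => RInt theta t0 t) p_infty p_infty.
Proof.
intros H Ha.
assert (Hi : forall t, t0 <= t -> in_interval a p_infty t).
{ intros t Ht; apply (in_interval_ge a p_infty t0); simpl; auto. }
pose proof (bianchiI_solution_orbit _ _ _ _ _ _ _ H) as Hx.
destruct H as [H HW].
assert (Hpos : forall t, t0 <= t -> 0 < theta t) by (intros t Ht; apply (Hx t (Hi t Ht))).
set (c := / theta t0).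
assert (Hc : 0 < c) by (apply Rinv_0_lt_compat, Hpos; lra).
assert (Hinv : forall t, t0 <= t -> / theta t <= c + (t - t0)).
{ intros t Ht.
  pose (x := normalized theta sigma psi V).
  assert (Hmono : t0 - / theta t0 <= t - / theta t); [|unfold c; lra].
  apply (nonneg_derive_le (fun s => s - / theta s) (fun s => 1 -
    (1 / 3 + 2 * S_coord (x s) ^ 2 - U_coord (x s) ^ 2 + P_coord (x s) ^ 2))); auto.
  - intros s Hs; apply (is_derive_minus (fun s => s) (fun s => / theta s)).
      apply (is_derive_id (K := R_AbsRing)).
    apply (is_derive_inv_theta lambda a p_infty); auto; apply Hi; lra.
  (* On W the derivative of [/ theta] equals 1 - 3 U^2, so the difference to 1 is 3 U^2. *)
  - intros s Hs; specialize (HW s (Hi s ltac:(lra))).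
    fold x in HW; unfold bianchiI_surface in HW.
    pose proof (pow2_ge_0 (U_coord (x s))); lra. }
assert (Hln : forall t, t0 <= t -> ln (c + (t - t0)) - ln c <= RInt theta t0 t).
{ intros t Ht.
  assert (Hmono : RInt theta t0 t0 - ln (c + (t0 - t0)) <= RInt theta t0 t - ln (c + (t - t0))).
  { apply (nonneg_derive_le (fun s => RInt theta t0 s - ln (c + (s - t0)))
      (fun s => theta s - / (c + (s - t0)))); auto.
    - intros s Hs; apply (is_derive_minus (fun s => RInt theta t0 s)).
        apply (continuous_is_derive_RInt a p_infty); try (apply Hi; lra).
        intros r Hr; apply (Hx r Hr).
      auto_derive; [lra|field; lra].
    - intros s Hs; pose proof (Hpos s ltac:(lra)) as Hp.
      assert (Hle : / (c + (s - t0)) <= / / theta s).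
      { apply Rinv_le_contravar; [now apply Rinv_0_lt_compat|apply Hinv; lra]. }
      rewrite Rinv_inv in Hle; lra. }
  rewrite RInt_point, Rminus_diag, Rplus_0_r in Hmono.
  change (@zero R_CompleteNormedModule) with 0 in Hmono; lra. }
apply is_lim_spec; intros M.
(* Beyond this time c + (t - t0) > c exp M, so the logarithmic lower bound exceeds [M]. *)
exists (t0 + c * exp M); intros t Ht.
pose proof (exp_pos M).
assert (Ht0 : t0 <= t) by nra.
apply Rlt_le_trans with (2 := Hln t Ht0).
assert (Hlt : ln (c * exp M) < ln (c + (t - t0))) by (apply ln_increasing; nra).
rewrite ln_mult, ln_exp in Hlt by assumption; lra.
Qed.

Lemma bianchiI_isotropizes (lambda : R) (a : Rbar) (theta sigma psi V : R -> R) (t0 : R) :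
  0 <= lambda < sqrt 6 -> Rbar_lt a t0 ->
  bianchiI_solution lambda a p_infty theta sigma psi V ->
  euclidean_dist (normalized theta sigma psi V t0) (P2 lambda) < basin_radius lambda ->
  isotropizes theta sigma.
Proof.
intros Hl Ha H Hr.
apply (S_coord_lim lambda (normalized theta sigma psi V)).
apply (orbit_converges lambda a theta _ t0); auto.
- now apply bianchiI_solution_orbit.
- now apply (is_lim_RInt_theta lambda a theta sigma psi V).
Qed.

(** * Absence of inflation near P2 *)

(** After division by theta^2, inflation reads P^2 < U^2. At P2 the squares are lambda^2/9 and (6 -
    lambda^2)/18, which cross at lambda^2 = 2. *)
Lemma P2_not_inflating (lambda : R) :
  sqrt 2 < lambda < sqrt 6 -> sqrt ((6 - lambda ^ 2) / 18) < lambda / 3.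
Proof.
intros [H2 H6]; pose proof (sqrt_lt_R0 2 ltac:(lra)).
pose proof (sqrt_sqrt 2 ltac:(lra)).
rewrite <- (sqrt_pow2 (lambda / 3)) by lra.
destruct (lambda_bounds lambda ltac:(lra)) as [Hl _].
assert (2 < lambda ^ 2) by nra.
apply sqrt_lt_1_alt; lra.
Qed.

(** For lambda > sqrt 2 the gap P - U at P2 is strictly positive. The radius is chosen so that
    neither coordinate ever moves by half the gap; U < P then holds at all later times. *)
Lemma bianchiI_not_inflating (lambda : R) :
  0 <= lambda < sqrt 6 -> sqrt 2 < lambda ->
  exists delta, 0 < delta /\
    forall (a : Rbar) (t0 : R) (theta sigma psi V : R -> R),
      Rbar_lt a t0 -> bianchiI_solution lambda a p_infty theta sigma psi V ->
      euclidean_dist (normalized theta sigma psi V t0) (P2 lambda) < delta ->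
      isotropizes theta sigma /\ forall t, t0 <= t -> ~ inflates psi V t.
Proof.
intros Hl H2.
pose proof (P2_not_inflating lambda ltac:(lra)) as Hgap.
destruct (basin_radius_bounds lambda Hl) as [Hu [Hr _]].
assert (HC : 0 < 3 / sqrt ((6 - lambda ^ 2) / 18)) by (apply Rdiv_lt_0_compat; lra).
pose (C := 2 + 3 / sqrt ((6 - lambda ^ 2) / 18)).
set (u := sqrt ((6 - lambda ^ 2) / 18)) in *.
assert (HC0 : 0 < C) by (unfold C; lra).
exists (Rmin (basin_radius lambda) ((lambda / 3 - u) / 2 / C)); split.
  apply Rmin_glb_lt; [lra|repeat apply Rdiv_lt_0_compat; lra].
intros a t0 theta sigma psi V Ha H Hd.
pose proof (Rlt_le_trans _ _ _ Hd (Rmin_l _ _)) as Hd1.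
pose proof (Rlt_le_trans _ _ _ Hd (Rmin_r _ _)) as Hd2.
split; [now apply (bianchiI_isotropizes lambda a theta sigma psi V t0)|].
intros t Ht.
pose proof (bianchiI_solution_orbit _ _ _ _ _ _ _ H) as Hx.
assert (H0 : in_interval a p_infty t0) by (split; simpl; auto).
assert (Hi : in_interval a p_infty t) by (apply (in_interval_ge a p_infty t0); simpl; auto).
destruct (orbit_in_basin lambda a p_infty theta _ t0 t Hl Hx H0 Hi Ht Hd1)
  as [HU [_ [_ [_ HD]]]].
fold u C in HD.
apply (Rmult_lt_compat_l C) in Hd2; [|exact HC0].
replace (C * ((lambda / 3 - u) / 2 / C)) with ((lambda / 3 - u) / 2) in Hd2 by (field; lra).
destruct (P2_dist_coords lambda (normalized theta sigma psi V t)) as [_ [HUu HPl]].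
fold u in HUu.
apply Rabs_le_between in HUu; apply Rabs_le_between in HPl.
assert (HUP : U_coord (normalized theta sigma psi V t) < P_coord (normalized theta sigma psi V t))
  by lra.
pose proof (potential_pos _ _ _ _ _ _ _ t (proj1 H) Hi) as HV.
destruct (Hx t Hi) as [_ [Hth _]].
unfold U_coord, P_coord, normalized in HU, HUP; simpl in HU, HUP.
apply (Rmult_lt_compat_r (theta t)) in HUP; [|exact Hth].
replace (sqrt (V t) / theta t * theta t) with (sqrt (V t)) in HUP by (field; lra).
replace (psi t / theta t * theta t) with (psi t) in HUP by (field; lra).
pose proof (sqrt_lt_R0 _ HV); pose proof (sqrt_sqrt (V t) ltac:(lra)).
unfold inflates; nra.
Qed.

(** * The exact solution corresponding to P2 *)

Lemma theta2_pos (lambda t : R) : 0 < lambda -> 0 < t -> 0 < theta2 lambda t.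
Proof.
intros Hl Ht; apply Rdiv_lt_0_compat; [lra|].
apply Rmult_lt_0_compat; [now apply pow_lt|exact Ht].
Qed.

Lemma normalized_exact_solution (lambda t : R) :
  0 < lambda < sqrt 6 -> 0 < t ->
  normalized (theta2 lambda) sigma2 (psi2 lambda) (V2 lambda) t = P2 lambda.
Proof.
intros Hl Ht; destruct (lambda_bounds lambda ltac:(lra)) as [H6 _].
pose proof (theta2_pos lambda t ltac:(lra) Ht) as Hth.
unfold normalized, P2; apply f_equal2; [apply f_equal2|].
- unfold sigma2, Rdiv; ring.
- replace (V2 lambda t) with ((6 - lambda ^ 2) / 18 * theta2 lambda t ^ 2)
    by (unfold V2, theta2; field; lra).
  rewrite sqrt_mult, sqrt_pow2 by (try apply pow2_ge_0; lra).
  field; lra.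
- unfold psi2, theta2; field; lra.
Qed.

(** In normalized variables the solution rests at the equilibrium P2, so both sides of the system
    vanish; what remains is a scalar field generating [psi2] and [V2]. *)
Lemma exact_solution_bianchiI (lambda : R) :
  0 < lambda < sqrt 6 ->
  bianchiI_solution lambda 0 p_infty (theta2 lambda) sigma2 (psi2 lambda) (V2 lambda).
Proof.
intros Hl; destruct (lambda_bounds lambda ltac:(lra)) as [H6 _].
split; [split|].
(* The field is a primitive of [psi2]; then exp(-lambda phi) = 1/t^2, and [V0] is the remaining
   coefficient of [V2]. *)
- exists (2 * (6 - lambda ^ 2) / lambda ^ 4), (fun t => 2 / lambda * ln t); split.
    apply Rdiv_lt_0_compat; [lra|apply pow_lt; lra].
  intros t [Ht _]; simpl in Ht; split.
  + replace (- lambda * (2 / lambda * ln t)) with (- (ln t + ln t)) by (field; lra).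
    rewrite exp_Ropp, exp_plus, exp_ln by exact Ht.
    unfold V2; field; lra.
  + unfold psi2; auto_derive; [exact Ht|field; lra].
- intros t Hit; pose proof Hit as [Ht _]; simpl in Ht; split.
    apply theta2_pos; lra.
  rewrite normalized_exact_solution, vector_field_P2 by lra.
  apply is_derive_ext_loc with (fun _ => P2 lambda);
    [|evar_last; [apply is_derive_const|symmetry; exact (scal_zero_r _)]].
  apply filter_imp with (2 := in_interval_open 0 p_infty t Hit).
  intros s [Hs _]; symmetry; now apply normalized_exact_solution.
- intros t [Ht _]; simpl in Ht.
  rewrite normalized_exact_solution by lra; apply bianchiI_P2; lra.
Qed.

(** The prefactor is positive, so the sign is that of lambda^2 - 2 at every time. *)
Lemma exact_solution_energy (lambda t : R) :
  0 < lambda -> 0 < t ->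
  psi2 lambda t ^ 2 - V2 lambda t = 6 / (lambda ^ 4 * t ^ 2) * (lambda ^ 2 - 2).
Proof. intros Hl Ht; unfold psi2, V2; field; lra. Qed.

Lemma exact_solution_inflates (lambda t : R) :
  0 < lambda -> 0 < t -> inflates (psi2 lambda) (V2 lambda) t <-> lambda < sqrt 2.
Proof.
intros Hl Ht; unfold inflates; rewrite exact_solution_energy by assumption.
assert (Hp : 0 < 6 / (lambda ^ 4 * t ^ 2)).
{ apply Rdiv_lt_0_compat; [lra|apply Rmult_lt_0_compat; apply pow_lt; lra]. }
pose proof (sqrt_lt_R0 2 ltac:(lra)); pose proof (sqrt_sqrt 2 ltac:(lra)).
split; intros H1.
- apply Rnot_le_lt; intros Hle; assert (0 <= lambda ^ 2 - 2) by nra; nra.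
- assert (lambda ^ 2 - 2 < 0) by nra; nra.
Qed.

Theorem mainTheorem6 (lambda : R) (hlambda : 0 <= lambda < sqrt 6) :
  (* W is invariant, P2 is a critical point lying on it *)
  invariant (vector_field lambda) bianchiI_surface /\
  bianchiI_surface (P2 lambda) /\
  vector_field lambda (P2 lambda) = (0, 0, 0) /\
  asymptotically_stable (vector_field lambda) bianchiI_surface (P2 lambda) /\
  (* isotropization, in the time tau and in the cosmic time t *)
  (exists delta : R, 0 < delta /\
     forall (a : Rbar) (x : R -> state),
       Rbar_lt a 0 -> solution_in (vector_field lambda) bianchiI_surface a p_infty x ->
       euclidean_dist (x 0) (P2 lambda) < delta ->
       is_lim (fun tau => S_coord (x tau)) p_infty 0) /\
  (exists delta : R, 0 < delta /\
     forall (a : Rbar) (t0 : R) (theta sigma psi V : R -> R),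
       Rbar_lt a t0 -> bianchiI_solution lambda a p_infty theta sigma psi V ->
       euclidean_dist (normalized theta sigma psi V t0) (P2 lambda) < delta ->
       isotropizes theta sigma) /\
  (* the exact solution corresponding to P2 *)
  (0 < lambda ->
     bianchiI_solution lambda 0 p_infty (theta2 lambda) sigma2 (psi2 lambda) (V2 lambda) /\
     (forall t : R, 0 < t ->
        normalized (theta2 lambda) sigma2 (psi2 lambda) (V2 lambda) t = P2 lambda) /\
     (lambda < sqrt 2 -> forall t : R, 0 < t -> inflates (psi2 lambda) (V2 lambda) t) /\
     (sqrt 2 <= lambda -> forall t : R, 0 < t -> ~ inflates (psi2 lambda) (V2 lambda) t)) /\
  (* isotropy is reached without inflation *)
  (sqrt 2 < lambda ->
     exists delta : R, 0 < delta /\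
       forall (a : Rbar) (t0 : R) (theta sigma psi V : R -> R),
         Rbar_lt a t0 -> bianchiI_solution lambda a p_infty theta sigma psi V ->
         euclidean_dist (normalized theta sigma psi V t0) (P2 lambda) < delta ->
         isotropizes theta sigma /\
         forall t : R, t0 <= t -> ~ inflates psi V t).
Proof.
destruct (basin_radius_bounds lambda hlambda) as [_ [Hr _]].
split; [apply bianchiI_invariant|].
split; [now apply bianchiI_P2|].
split; [now apply vector_field_P2|].
split; [split; [now apply P2_lyapunov_stable|now apply P2_attractive]|].
split.
{ exists (basin_radius lambda); split; [exact Hr|].
  intros a x Ha Hx Hd; apply (S_coord_lim lambda x).
  now apply (solution_converges lambda a). }
split.
{ exists (basin_radius lambda); split; [exact Hr|].
  intros a t0 theta sigma psi V; now apply bianchiI_isotropizes. }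
split; [|now apply bianchiI_not_inflating].
intros Hl; split; [apply exact_solution_bianchiI; lra|].
split; [intros t; apply normalized_exact_solution; lra|].
split; intros H2 t Ht.
- now apply exact_solution_inflates.
- rewrite exact_solution_inflates by assumption; lra.
Qed.
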